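(* Let $X$, $Y$, $\mathcal{S}$, $\mathcal{R}$, $\phi$ satisfy conditions (C1)–(C6) listed in the context, and let $\mathcal{T}_{\alpha,y}(x) = \mathcal{S}(x,y)+\alpha\mathcal{R}(x)$. Let $y^\delta\in Y$, $\alpha>0$, let $(y_k)_k$ be a sequence in $Y$ with $y_k\to y^\delta$, and assume that $x_k\in X$ and $z_k\in X^*$ are such that $$z_k\in\partial_{\alpha\phi}\big(\mathcal{S}(\cdot,y_k)+\alpha\mathcal{R}(\cdot)\big)(x_k),\qquad \|z_k\|\to0,\qquad \langle z_k,x_k\rangle\le0 .$$ Then the sequence $(x_k)_k$ has a weakly convergent subsequence, and the limit $x_+$ of every weakly convergent subsequence is an $\alpha\phi$-critical point of $\mathcal{T}_{\alpha,y^\delta}$.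
   Context: Relative subgradients: for a Banach space $X$ with dual $X^*$, $F\colon X\to\mathbb{R}$ and $\psi\colon X\to[0,\infty)$, the set $\partial_\psi F(x)$ consists of all $r\in X^*$ with $F(x)+\langle r,u-x\rangle\le F(u)+\psi(u)$ for all $u\in X$. $F$ is relatively sub-differentiable with bound $\psi$ if $\partial_\psi F(x)\ne\emptyset$ for all $x\in X$. A point $x$ is a $\psi$-critical point of $F$ if $0\in\partial_\psi F(x)$. Setting: $\mathcal{S}\colon X\times Y\to[0,\infty)$, $\mathcal{R}\colon X\to[0,\infty)$, $\phi\colon X\to[0,\infty)$ and: (C1) $X$ is a reflexive Banach space and $Y$ is a metric space with metric $\mathcal{D}$. (C2) $\mathcal{R}$ is weakly sequentially lower semi-continuous. (C3) $\mathcal{R}$ is relatively sub-differentiable with bound $\phi$. (C4) $\mathcal{S}$ is weakly sequentially lower semi-continuous (i.e. $x_k\rightharpoonup x$ weakly in $X$ and $y_k\to y$ in $Y$ imply $\mathcal{S}(x,y)\le\liminf_k\mathcal{S}(x_k,y_k)$), convex in its first argument and continuous in its second argument. (C5) There exist $C>0$ and $p\ge1$ such that $\mathcal{S}(z,y)\le C\big(\mathcal{S}(z,y')+\mathcal{D}(y,y')^p\big)$ for all $z\in X$ and $y,y'\in Y$. (C6) For all $\alpha>0$ and $y\in Y$ the functional $\mathcal{T}_{\alpha,y}$ is coercive, i.e. $\mathcal{T}_{\alpha,y}(x)\to\infty$ as $\|x\|\to\infty$. *)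

(* Defs.v *)
From HB Require Import structures.
From mathcomp Require Import all_boot all_order all_algebra.
From mathcomp Require Import all_classical all_reals all_analysis.

Set Implicit Arguments.
Unset Strict Implicit.
Unset Printing Implicit Defensive.

Import Order.TTheory GRing.Theory Num.Def Num.Theory.
Import numFieldNormedType.Exports.

Local Open Scope classical_set_scope.
Local Open Scope ring_scope.

Section dual_type.
Context {R : realType} (V : normedModType R).

Definition continuous_linear_form : {pred V -> R^o} :=
  [pred f : V -> R^o | `[< linear f /\ continuous f >]].

Record dual := Dual {
  dual_fun :> V -> R^o ;
  dual_funP : dual_fun \in continuous_linear_form }.

HB.instance Definition _ := [isSub for dual_fun].
HB.instance Definition _ := [Choice of dual by <:].

Lemma continuous_linear_form_submod_closed :
  submod_closed continuous_linear_form.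
Proof.
split; first by apply/asboolP; split => [a x y|x] /=;
  [rewrite scaler0 addr0|exact: cvg_cst].
move=> a f g /asboolP[lf cf] /asboolP[lg cg]; apply/asboolP; split.
  move=> b x y; rewrite !fctE lf lg !scalerDr !scalerA (mulrC a b).
  by rewrite addrACA.
by move=> x; apply: cvgD; [apply: cvgZr; exact: cf|exact: cg].
Qed.

HB.instance Definition _ := GRing.isSubmodClosed.Build _ _
  continuous_linear_form continuous_linear_form_submod_closed.
HB.instance Definition _ := [SubChoice_isSubLmodule of dual by <:].

Lemma dual_linear (f : dual) : linear f.
Proof. by case: f => f /= /asboolP[]. Qed.

HB.instance Definition _ (f : dual) :=
  GRing.isLinear.Build R V R^o _ (dual_fun f) (dual_linear f).

Lemma dual_continuous (f : dual) : continuous f.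
Proof. by case: f => f /= /asboolP[]. Qed.

Lemma dualP (f g : dual) : f =1 g -> f = g.
Proof. by move=> fg; apply/val_inj/funext. Qed.

Lemma dual0E x : (0 : dual) x = 0. Proof. by []. Qed.

Lemma dualDE (f g : dual) x : (f + g) x = f x + g x. Proof. by []. Qed.

Lemma dualZE (a : R) (f : dual) x : (a *: f) x = a * f x. Proof. by []. Qed.

Definition dual_norm (f : dual) : R := sup [set `|f x| | x in [set x | `|x| <= 1]].

Lemma dual_norm_has_sup (f : dual) :
  has_sup [set `|f x| | x in [set x | `|x| <= 1]].
Proof.
split; first by exists `|f 0|, 0 => //=; rewrite normr0 ler01.
have /linear_boundedP : bounded_near f (nbhs (0 : V)).
  by apply/linear_bounded_continuous; exact: dual_continuous.
move=> /pinfty_ex_gt0[M M0 fM]; exists M => _ [x /= x1 <-].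
by rewrite (le_trans (fM x))// -[leRHS]mulr1 ler_wpM2l// ltW.
Qed.

Lemma dual_norm_ge0 (f : dual) : 0 <= dual_norm f.
Proof.
apply: (@le_trans _ _ `|f 0|) => //.
by apply: ub_le_sup; [exact: (dual_norm_has_sup f).2|exists 0 => //=; rewrite normr0].
Qed.

Lemma le_dual_norm (f : dual) x : `|f x| <= dual_norm f * `|x|.
Proof.
have [->|x0] := eqVneq x 0; first by rewrite linear0 !normr0 mulr0.
have nx0 : 0 < `|x| by rewrite normr_gt0.
rewrite -ler_pdivrMr//.
have -> : `|f x| / `|x| = `|f (`|x|^-1 *: x)|.
  by rewrite linearZ/= normrZ normfV normr_id mulrC.
apply: ub_le_sup; first exact: (dual_norm_has_sup f).2.
by exists (`|x|^-1 *: x) => //=; rewrite normrZ normfV normr_id mulVf ?gt_eqF.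
Qed.

Lemma dual_norm_le (f : dual) M : 0 <= M ->
  (forall x, `|f x| <= M * `|x|) -> dual_norm f <= M.
Proof.
move=> M0 fM; apply: ge_sup; first exact: (dual_norm_has_sup f).1.
by move=> _ [x /= x1 <-]; rewrite (le_trans (fM x))// -[leRHS]mulr1 ler_wpM2l.
Qed.

Let ler_dual_normD f g : dual_norm (f + g) <= dual_norm f + dual_norm g.
Proof.
apply: dual_norm_le => [|x]; first by rewrite addr_ge0// dual_norm_ge0.
by rewrite dualDE (le_trans (ler_normD _ _))// mulrDl lerD// le_dual_norm.
Qed.

Let dual_normZ_le (a : R) f : dual_norm (a *: f) <= `|a| * dual_norm f.
Proof.
apply: dual_norm_le => [|x]; first by rewrite mulr_ge0// dual_norm_ge0.
by rewrite dualZE normrM -mulrA ler_wpM2l// le_dual_norm.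
Qed.

Let dual_normZ (a : R) f : dual_norm (a *: f) = `|a| * dual_norm f.
Proof.
apply/le_anti/andP; split; first exact: dual_normZ_le.
have [->|a0] := eqVneq a 0; first by rewrite normr0 mul0r dual_norm_ge0.
rewrite -ler_pdivlMl ?normr_gt0//.
by rewrite -[f in leLHS](scalerK a0) (le_trans (dual_normZ_le _ _))// normfV.
Qed.

Let dual_norm_eq0 f : dual_norm f = 0 -> f = 0.
Proof.
move=> f0; apply: dualP => x; apply/normr0_eq0/le_anti.
by rewrite normr_ge0 andbT (le_trans (le_dual_norm f x))// f0 mul0r.
Qed.

HB.instance Definition _ :=
  Lmodule_isNormed.Build R dual ler_dual_normD dual_normZ dual_norm_eq0.

Lemma dual_normE (f : dual) :
  `|f| = sup [set `|f x| | x in [set x | `|x| <= 1]].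
Proof. by []. Qed.

Definition weakly_cvg (u : V^nat) (x : V) :=
  forall f : dual, f (u k) @[k --> \oo] --> f x.

End dual_type.

(* The canonical embedding of V into its bidual is onto. *)
Definition reflexive_space {R : realType} (V : normedModType R) :=
  forall g : dual (dual V), exists x : V, forall f : dual V, g f = f x.

Section relative_subgradients.
Context {R : realType} {V : normedModType R}.
Implicit Types (psi F : V -> R) (x : V).

Definition relative_subdifferential psi F x : set (dual V) :=
  [set r | forall u, F x + r (u - x) <= F u + psi u].

Definition relatively_subdifferentiable psi F :=
  forall x, relative_subdifferential psi F x !=set0.

Definition relative_critical_point psi F x :=
  relative_subdifferential psi F x 0.

End relative_subgradients.

Section conditions.
Context {R : realType} {X : normedModType R} {Y : metricType R}.
Implicit Types (F : X -> R) (S : X -> Y -> R).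

(* The liminf is taken in \bar R, where it always exists: along an arbitrary
   weakly convergent sequence it may be +oo. *)
Definition weakly_seq_lsc F := forall (u : X^nat) (x : X),
  weakly_cvg u x -> ((F x)%:E <= limn_einf (fun k => (F (u k))%:E))%E.

Definition weakly_seq_lsc2 S := forall (u : X^nat) (x : X) (v : Y^nat) (y : Y),
  weakly_cvg u x -> v @ \oo --> y ->
  ((S x y)%:E <= limn_einf (fun k => (S (u k) (v k))%:E))%E.

Definition coercive F := forall M : R, exists r : R,
  forall x, r <= `|x| -> M <= F x.

Definition tikhonov S F (alpha : R) (y : Y) : X -> R :=
  fun x => S x y + alpha * F x.

End conditions.

(* Main.v *)
(** Testing the subgradient inequality at [u = 0] bounds the Tikhonov functionals
    along [x_k], so the [x_k] are bounded by coercivity; since [<z_k, x_k> <= 0]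
    and [z_k -> 0], lower semi-continuity passes the inequality to the limit.

    Weak sequential compactness of bounded sequences is obtained from
    ultrafilters: along an ultrafilter a bounded sequence induces a bounded
    functional on the dual, which by reflexivity is the evaluation at a point.
    Such a limit lies in the closed span of the sequence, where countably many
    norming functionals separate points.  A subsequence along which these
    countably many functionals converge therefore has only one ultralimit. *)
Require Import Defs.
From HB Require Import structures.
From mathcomp Require Import all_boot all_order all_algebra.
From mathcomp Require Import all_classical all_reals all_analysis.
From mathcomp Require Import lra.
Import Order.TTheory GRing.Theory Num.Def Num.Theory.
Import numFieldNormedType.Exports.
Local Open Scope classical_set_scope.
Local Open Scope ring_scope.

(** * Sublinear functions and the Hahn-Banach theorem *)

Section sublinear.
Context {R : realType} {V : lmodType R}.
Implicit Types (p q : V -> R) (u v : V).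

(** Homogeneity is asked only as an inequality, which is easier to check for infima; applying it to
    [t^-1] as well recovers equality. *)
Definition sublinear p := (forall u v, p (u + v) <= p u + p v) /\
  (forall (t : R) v, 0 <= t -> p (t *: v) <= t * p v).

Lemma sublinearZ p t v : sublinear p -> 0 <= t -> p (t *: v) = t * p v.
Proof.
move=> [pD pZ]; rewrite le_eqVlt => /predU1P[<-|t0].
  have := pZ 0 0 (lexx 0); have := pD 0 0.
  by rewrite !scale0r addr0; lra.
apply/le_anti; rewrite pZ ?(ltW t0)//= -ler_pdivlMl//.
by rewrite -[in leLHS](scalerK (lt0r_neq0 t0) v) pZ// invr_ge0 ltW.
Qed.

Lemma sublinear0 p : sublinear p -> p 0 = 0.
Proof. by move=> pl; rewrite -[in LHS](scale0r 0) sublinearZ// mul0r. Qed.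

Lemma sublinear_geN p v : sublinear p -> - p (- v) <= p v.
Proof.
move=> pl; have := pl.1 v (- v); rewrite subrr sublinear0//; lra.
Qed.

(** Serves three infima: over shifts, over a chain in Zorn's lemma, and over combinations
    approximating a vector. The slack [e] allows for coefficients that are only rational. *)
Lemma sublinear_inf (I : Type) (i0 : I) (F : I -> V -> R) :
  (forall v, has_lbound (range (F^~ v))) ->
  (forall i j u v, exists k, F k (u + v) <= F i u + F j v) ->
  (forall i t v e, 0 <= t -> 0 < e ->
    exists k, F k (t *: v) <= t * F i v + e) ->
  sublinear (fun v => inf (range (F^~ v))).
Proof.
move=> Flb FD FZ.
have F0 v : range (F^~ v) !=set0 by exists (F i0 v), i0.
have infF i v : inf (range (F^~ v)) <= F i v by apply: ge_inf => //; exists i.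
have Finf v e : 0 < e -> exists i, F i v < inf (range (F^~ v)) + e.
  move=> e0; have [|_ [i _ <-] Fi] := @inf_adherent _ (range (F^~ v)) e e0.
    by split.
  by exists i.
split=> [u v|t v t0]; apply/ler_addgt0Pr => e e0.
  have e20 : 0 < e / 2 by rewrite divr_gt0.
  have [i Fi] := Finf u _ e20; have [j Fj] := Finf v _ e20.
  have [k Fk] := FD i j u v; have := infF k (u + v); lra.
have t1 : 0 < t + 1 by rewrite ltr_wpDl.
have e20 : 0 < e / 2 by rewrite divr_gt0.
have [i Fi] := Finf v (e / 2 / (t + 1)) (divr_gt0 e20 t1).
have [k Fk] := FZ i t v (e / 2) t0 e20.
rewrite (le_trans (infF k _))// (le_trans Fk)//.
have : t * F i v <= t * (inf (range (F^~ v)) + e / 2 / (t + 1)).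
  by rewrite ler_wpM2l// ltW.
have : t * (e / 2 / (t + 1)) <= e / 2.
  by rewrite mulrCA ler_piMr ?ltW// -?mulrA// ltr_pdivrMr// mul1r ltrDl.
by rewrite mulrDr; lra.
Qed.

(** Take [q v] to be the infimum of [p (v + t *: a) - t * p a] over [t >= 0]; subadditivity bounds
    it below by [- p (- v)]. *)
Lemma sublinear_shift p a : sublinear p -> exists2 q, sublinear q &
  forall v t, 0 <= t -> q v <= p (v + t *: a) - t * p a.
Proof.
move=> pl; pose F (t : {t : R | 0 <= t}) v := p (v + sval t *: a) - sval t * p a.
have Flb v : has_lbound (range (F^~ v)).
  exists (- p (- v)) => _ [[t t0] _ <-]; rewrite /F /= -(sublinearZ _ _ _ pl t0).
  by have := pl.1 (v + t *: a) (- v); rewrite addrAC subrr add0r; lra.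
exists (fun v => inf (range (F^~ v))); last first.
  by move=> v t t0; apply: ge_inf => //; exists (exist _ t t0).
apply: sublinear_inf (exist _ 0 (lexx 0)) _ Flb _ _.
- move=> [s s0] [t t0] u v; exists (exist _ (s + t) (addr_ge0 s0 t0)).
  rewrite /F/=.
  by have := pl.1 (u + s *: a) (v + t *: a); rewrite addrACA -scalerDl; lra.
- move=> [s s0] t v e t0 e0; exists (exist _ (t * s) (mulr_ge0 t0 s0)).
  rewrite /F /= -scalerA -scalerDr sublinearZ//; lra.
Qed.

(** Zorn's lemma for the reversed pointwise order: a nonempty chain is bounded by its pointwise
    infimum, which is finite because each member [q] satisfies [- p (- v) <= q v]. *)
Lemma minimal_sublinear p : sublinear p -> exists2 q, sublinear q &
  (forall v, q v <= p v) /\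
  forall q', sublinear q' -> (forall v, q' v <= q v) -> q' = q.
Proof.
move=> pl; pose T := {q : V -> R | sublinear q /\ forall v, q v <= p v}.
pose geT (q1 q2 : T) := `[< forall v, sval q2 v <= sval q1 v >].
have [|||[q [ql qp]] qmin] :=
  @ZL_preorder T (exist _ p (conj pl (fun=> lexx _))) geT.
- by move=> q; apply/asboolP.
- move=> q1 q2 q3 /asboolP q21 /asboolP q32; apply/asboolP => v.
  exact: le_trans (q32 v) (q21 v).
- move=> A Atot.
  have [[a0 Aa0]|A0] := pselect (A !=set0); last first.
    by exists (exist _ p (conj pl (fun=> lexx _))) => q Aq; case: A0; exists q.
  pose F (i : {q | A q}) v := sval (sval i) v.
  have Flb v : has_lbound (range (F^~ v)).
    exists (- p (- v)) => _ [[[q [ql qp]] Aq] _ <-]; rewrite /F/=.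
    by have := sublinear_geN _ v ql; have := qp (- v); lra.
  have infF i v : inf (range (F^~ v)) <= F i v.
    by apply: ge_inf => //; exists i.
  have Fl : sublinear (fun v => inf (range (F^~ v))).
    apply: sublinear_inf (exist _ a0 Aa0) _ Flb _ _.
    + move=> [q1 Aq1] [q2 Aq2] u v.
      have [/asboolP q21|/asboolP q12] := Atot _ _ Aq1 Aq2.
        exists (exist _ _ Aq2); rewrite /F/=.
        have := (svalP q2).1.1 u v; have := q21 u; lra.
      exists (exist _ _ Aq1); rewrite /F/=.
      have := (svalP q1).1.1 u v; have := q12 v; lra.
    + move=> i t v e t0 e0; exists i; rewrite /F sublinearZ//; first by lra.
      exact: (svalP (sval i)).1.
  have Fp v : inf (range (F^~ v)) <= p v.
    by rewrite (le_trans (infF (exist _ a0 Aa0) v))// (svalP a0).2.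
  exists (exist _ (fun v => inf (range (F^~ v))) (conj Fl Fp)) => q Aq.
  apply/asboolP => v /=.
  exact: (infF (exist _ q Aq)).
exists q => //; split=> // q' q'l q'q.
have q'p v : q' v <= p v by rewrite (le_trans (q'q v)).
have /asboolP /= := qmin (exist _ q' (conj q'l q'p)) (asboolT q'q).
by move=> qq'; apply/funext => v; apply/le_anti; rewrite q'q qq'.
Qed.

(* Shifting by [x] forces [f (- x) <= - p x]; a minimal sublinear function is
   additive since it coincides with each of its own shifts. *)
Lemma hahn_banach_sublinear p x : sublinear p -> exists f : V -> R,
  [/\ linear (f : V -> R^o), forall v, f v <= p v & f x = p x].
Proof.
move=> pl; have [p' p'l p'p] := sublinear_shift _ x pl.
have [f fl [fp' fmin]] := minimal_sublinear _ p'l.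
have fp v : f v <= p v.
  have := p'p v 0 (lexx 0); rewrite scale0r addr0 mul0r subr0.
  exact: le_trans (fp' v).
have fD u v : f (u + v) = f u + f v.
  apply/le_anti; rewrite fl.1/=.
  have [q ql qf] := sublinear_shift _ v fl.
  have -> : f u = q u.
    suff -> : q = f by [].
    apply: fmin => // w.
    by have := qf w 0 (lexx 0); rewrite scale0r addr0 mul0r subr0.
  by have := qf u 1 ler01; rewrite scale1r mul1r; lra.
have fN v : f (- v) = - f v.
  by apply/eqP; rewrite -addr_eq0 -fD addNr (sublinear0 _ fl).
exists f; split => //.
  move=> t u v; rewrite fD; congr (_ + _).
  have [t0|/ltW t0] := leP 0 t; first exact: sublinearZ.
  rewrite -[t in LHS]opprK scaleNr fN sublinearZ ?oppr_ge0//.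
  by rewrite mulNr opprK.
apply/le_anti; rewrite fp/=.
have := p'p (- x) 1 ler01; rewrite scale1r mul1r addNr (sublinear0 _ pl).
by have := fp' (- x); rewrite fN; lra.
Qed.

End sublinear.

(** * Ultrafilter limits and extraction of subsequences *)

Lemma cvg_ultra (T : Type) (U : topologicalType) (F : set_system T)
    (f : T -> U) (l : U) : Filter F ->
  (forall G, UltraFilter G -> F `<=` G -> f @ G --> l) -> f @ F --> l.
Proof.
move=> FF fG A Al; apply: contrapT => nFA.
(* If [F] misses the preimage of [A], then [F] and the complement of that preimage lie in a common
   ultrafilter, along which [f] cannot converge to [l]. *)
pose D := ~` (f @^-1` A).
have wP : ProperFilter (within D F).
  split; last exact: within_filter.
  move=> w0; apply: nFA; apply: (@filterS _ F _ _ _ _ w0) => t /= Dt.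
  by apply: contrapT => /Dt.
have [G [GU wG]] := ultraFilterLemma wP.
have GA : G (f @^-1` A).
  by apply: fG => //; apply: subset_trans wG; exact: cvg_within.
have GD : G D by apply: wG; exact: withinT.
by have /filter_ex [t []] : G (D `&` (f @^-1` A)) by exact: filterI.
Qed.

(** Compactness of [[-M, M]] yields a cluster point, and an ultrafilter converges to each of its
    cluster points. *)
Lemma ultra_bounded_cvg (R : realType) (T : Type) (G : set_system T)
    (f : T -> R) (M : R) : UltraFilter G -> (forall t, `|f t| <= M) ->
  exists l : R, f @ G --> l.
Proof.
move=> GU fM; have fGM : (f @ G) `[- M, M]%classic.
  by apply: (@filterE _ G) => t; rewrite /= in_itv/= -ler_norml; exact: fM.
have [l [_ fl]] := @segment_compact _ _ _ (f @ G) _ fGM.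
exists l => A Al; have [//|GnA] := in_ultra_setVsetC (f @^-1` A) GU.
by have [y [nAy /nAy]] := fl (~` A) A GnA Al.
Qed.

(** Finitely many closeness conditions hold on a common set of [F], which also meets every tail of
    the naturals. So the [j]-th index can be chosen beyond the previous one and good for the first
    [j + 1] sequences at once. *)
Lemma diagonal_subsequence (R : realType) (F : set_system nat)
    (g : nat -> nat -> R) (a : nat -> R) : ProperFilter F -> \oo `<=` F ->
  (forall m, g m @ F --> a m) ->
  exists2 s : nat -> nat, increasing_seq s &
    forall m, g m (s j) @[j --> \oo] --> a m.
Proof.
move=> FP Foo ga.
have next (jn : nat * nat) : exists k, (jn.2 <= k)%N /\
    forall m, (m <= jn.1)%N -> `|a m - g m k| < jn.1.+1%:R^-1.
  case: jn => j n /=.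
  have : \forall k \near F, (n <= k)%N /\
      forall m : 'I_j.+1, `|a m - g m k| < j.+1%:R^-1.
    apply: filterI; first by apply: Foo; exact: nbhs_infty_ge.
    apply: filter_forall => m.
    by have /cvgrPdist_lt := ga m; apply; rewrite invr_gt0 ltr0n.
  move=> /filter_ex [k [nk gk]]; exists k; split => // m mj.
  by have := gk (Ordinal (mj : m < j.+1)%N).
have [h hP] := choice next.
(* The first argument of [h] sets the accuracy, the second is a lower bound forcing strict
   increase. *)
pose fix s j := if j is i.+1 then h (j, (s i).+1) else h (0, 0)%N.
exists s.
  apply/increasing_seqP => j.
  by have [] := hP (j.+1, (s j).+1).
have sP j m : (m <= j)%N -> `|a m - g m (s j)| < j.+1%:R^-1.
  by case: j => [|j]; [have [_] := hP (0, 0)%N|have [_] := hP (j.+1, (s j).+1)];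
     apply.
move=> m; apply/cvgrPdist_lt => e e0.
have je : \forall j \near \oo, j.+1%:R^-1 < e.
  exact: near_infty_natSinv_lt (PosNum e0).
near=> j.
have mj : (m <= j)%N by near: j; exact: nbhs_infty_ge.
apply: lt_trans (sP _ _ mj) _; near: j; exact: je.
Unshelve. all: by end_near. Qed.

(** * Continuous functionals: extension, norming and ultralimits *)

Lemma dual_of_bounded (R : realType) (V : normedModType R) (f : V -> R^o) (M : R) : linear f ->
  (forall v, `|f v| <= M * `|v|) -> exists g : dual V, g =1 f.
Proof.
move=> lf fM.
pose fL : {linear V -> R^o} := HB.pack f (GRing.isLinear.Build R V R^o _ f lf).
have cf : continuous f.
  apply: (@bounded_linear_continuous R V R^o fL); apply/linear_boundedP.
  near=> r => v; apply: le_trans (fM v) _.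
  by apply: ler_wpM2r => //; near: r; apply: nbhs_pinfty_ge; exact: num_real.
have fP : f \in @continuous_linear_form R V by apply/asboolP.
by exists (Dual fP).
Unshelve. all: by end_near. Qed.

Section duality.
Context {R : realType} {V : normedModType R}.

Lemma hahn_banach_seminorm (p : V -> R) (x : V) :
  sublinear p -> (forall v, p v <= `|v|) ->
  exists f : dual V, (forall v, f v <= p v) /\ f x = p x.
Proof.
move=> pl pn; have [f [lf fp fx]] := hahn_banach_sublinear p x pl.
have [|g gf] := dual_of_bounded _ _ f 1 lf.
  pose fL : {linear V -> R^o} := HB.pack f (GRing.isLinear.Build R V R^o _ f lf).
  move=> v; rewrite mul1r ler_norml lerNl -[- f v](linearN fL).
  rewrite (le_trans (fp _))//= 1?(le_trans (fp _))//.
  by rewrite -(normrN v).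
by exists g; split => [v|]; rewrite gf.
Qed.

Lemma norming_functional (x : V) :
  exists f : dual V, (forall v, `|f v| <= `|v|) /\ f x = `|x|.
Proof.
have nl : sublinear (fun v : V => `|v|).
  split=> [u v|t v t0]; first exact: ler_normD.
  by rewrite normrZ ger0_norm.
have [f [fn fx]] := hahn_banach_seminorm _ x nl (fun=> lexx _).
exists f; split=> // v.
by rewrite ler_norml fn andbT lerNl -linearN -(normrN v) fn.
Qed.

Lemma reflexive_ultralimit (T : Type) (G : set_system T) (u : T -> V) (M : R) :
  reflexive_space V -> UltraFilter G -> (forall t, `|u t| <= M) ->
  exists x, forall f : dual V, f (u t) @[t --> G] --> f x.
Proof.
move=> Vr GU uM.
have fuM (f : dual V) t : `|f (u t)| <= M * `|f|.
  by rewrite mulrC (le_trans (le_dual_norm f (u t)))// ler_wpM2l// dual_norm_ge0.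
have fl (f : dual V) : exists l : R, f (u t) @[t --> G] --> l.
  exact: ultra_bounded_cvg (fuM f).
have [l lP] := choice fl.
have lD (f g : dual V) : l (f + g) = l f + l g.
  by apply: (cvg_unique _ (lP (f + g))) => //; exact: cvgD (lP f) (lP g).
have lZ (a : R) (f : dual V) : l (a *: f) = a * l f.
  by apply: (cvg_unique _ (lP (a *: f))) => //; exact: cvgMl_tmp (lP f).
have [||h hl] := dual_of_bounded _ (dual V) l M.
- by move=> a f g; rewrite lD lZ.
- move=> f; rewrite -[leLHS]/(normr _); have /cvg_norm lf := lP f.
  rewrite -(cvg_lim _ lf)//; apply: limr_le.
    by apply/cvg_ex; eexists; exact: lf.
  by apply: nearW => t; exact: fuM.
have [x hx] := Vr h; exists x => f.
by rewrite -hx hl; exact: lP.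
Qed.

End duality.

(** * Weak sequential compactness of bounded sequences *)

Section weak_compactness.
Context {R : realType} {V : normedModType R}.
Implicit Types (u : V^nat) (x : V) (s : seq (nat * rat)).

(** Rational coefficients keep the index type countable while the combinations stay dense in the
    span. *)
Definition rational_comb u s : V := \sum_(c <- s) ratr c.2 *: u c.1.

Lemma rational_combD u s s' :
  rational_comb u (s ++ s') = rational_comb u s + rational_comb u s'.
Proof. exact: big_cat. Qed.

Lemma rational_combZ u (q : rat) s :
  rational_comb u [seq (c.1, q * c.2) | c <- s] = ratr q *: rational_comb u s.
Proof.
rewrite /rational_comb big_map scaler_sumr.
by apply: eq_bigr => c _; rewrite /= rmorphM scalerA.
Qed.

Definition comb_dist u x := inf (range (fun s => `|x - rational_comb u s|)).

Lemma comb_dist_lbound u x :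
  has_lbound (range (fun s => `|x - rational_comb u s|)).
Proof. by exists 0 => _ [s _ <-]. Qed.

Lemma comb_dist_le u x s : comb_dist u x <= `|x - rational_comb u s|.
Proof. by apply: ge_inf; [exact: comb_dist_lbound|exists s]. Qed.

Lemma comb_dist_sublinear u : sublinear (comb_dist u).
Proof.
apply: (sublinear_inf _ [::] (fun s x => `|x - rational_comb u s|)).
- exact: comb_dist_lbound.
- move=> s s' x y; exists (s ++ s').
  by rewrite rational_combD opprD addrACA ler_normD.
- move=> s t x e t0 e0; set d := rational_comb u s.
  have d1 : 0 < `|d| + 1 by rewrite ltr_wpDl.
  (* Replacing [t] by a rational [q] this close costs at most [e] in norm; the [+ 1] covers
     [d = 0]. *)
  have /rat_in_itvoo[q] : t < t + e / (`|d| + 1) by rewrite ltrDl divr_gt0.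
  rewrite in_itv/= => /andP[tq qt].
  exists [seq (c.1, q * c.2) | c <- s]; rewrite rational_combZ -/d.
  have -> : t *: x - ratr q *: d = t *: (x - d) + (t - ratr q) *: d.
    by rewrite scalerBr scalerBl addrA subrK.
  rewrite (le_trans (ler_normD _ _))// !normrZ (ger0_norm t0) lerD2l.
  rewrite distrC ger0_norm ?subr_ge0 ?(ltW tq)//.
  have : (ratr q - t) * (`|d| + 1) <= e by rewrite -ler_pdivlMr// lerBlDl ltW.
  by apply: le_trans; rewrite ler_wpM2l ?lerDl// subr_ge0 ltW.
Qed.

Lemma comb_dist_eq0_ex u x e : comb_dist u x <= 0 -> 0 < e ->
  exists s, `|x - rational_comb u s| < e.
Proof.
move=> x0 e0.
have [|_ [s _ <-] xs] := @inf_adherent _ _ e e0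
    (_ : has_inf (range (fun s => `|x - rational_comb u s|))).
  by split; [exists `|x - rational_comb u [::]|, [::]|exact: comb_dist_lbound].
by exists s; apply: lt_le_trans xs _; rewrite gerDr.
Qed.

(* A functional dominated by the distance to the span vanishes on the [u k],
   hence at their weak limit. *)
Lemma weak_limit_comb_dist (F : set_system nat) u x : ProperFilter F ->
  (forall f : dual V, f (u k) @[k --> F] --> f x) -> comb_dist u x <= 0.
Proof.
move=> FP ux.
have dn v : comb_dist u v <= `|v|.
  by have := comb_dist_le u v [::]; rewrite /rational_comb big_nil subr0.
have [f [fd <-]] := hahn_banach_seminorm _ x (comb_dist_sublinear u) dn.
have fu k : f (u k) = 0.
  apply/le_anti/andP; split.
    rewrite (le_trans (fd _))// (le_trans (comb_dist_le _ _ [:: (k, 1)]))//.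
    by rewrite /rational_comb big_seq1/= rmorph1 scale1r subrr normr0.
  rewrite -oppr_le0 -linearN (le_trans (fd _))//.
  rewrite (le_trans (comb_dist_le _ _ [:: (k, -1)]))//.
  by rewrite /rational_comb big_seq1/= rmorphN1 scaleN1r subrr normr0.
have := ux f; under eq_fun do rewrite fu.
by move=> /(cvg_unique _ (cvg_cst 0 : _ --> (0 : R))) <-.
Qed.

(** Some combination [w] lies within [e / 2] of [x - y]. Its norming functional vanishes on [x - y],
    so the norm of [w] is at most [e / 2] too, and that of [x - y] at most [e]. *)
Lemma weak_limit_unique (F G : set_system nat) (N : seq (nat * rat) -> dual V)
    u x y : ProperFilter F -> ProperFilter G ->
  (forall s, (forall v, `|N s v| <= `|v|) /\
    N s (rational_comb u s) = `|rational_comb u s|) ->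
  (forall f : dual V, f (u k) @[k --> F] --> f x) ->
  (forall f : dual V, f (u k) @[k --> G] --> f y) ->
  (forall s, N s x = N s y) -> x = y.
Proof.
move=> FP GP NP ux uy Nxy.
apply/eqP; rewrite -subr_eq0 -normr_le0; apply/ler_addgt0Pr => e e0; rewrite add0r.
have e4 : 0 < e / 4 by rewrite divr_gt0.
have [s xs] := comb_dist_eq0_ex _ _ _ (weak_limit_comb_dist _ _ _ _ ux) e4.
have [s' ys] := comb_dist_eq0_ex _ _ _ (weak_limit_comb_dist _ _ _ _ uy) e4.
pose s2 := s ++ [seq (c.1, -1 * c.2) | c <- s'].
have s2E : rational_comb u s2 = rational_comb u s - rational_comb u s'.
  by rewrite rational_combD rational_combZ rmorphN1 scaleN1r.
have ds : `|(x - y) - rational_comb u s2| <= e / 2.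
  have -> : x - y - rational_comb u s2 =
      (x - rational_comb u s) - (y - rational_comb u s').
    by rewrite s2E !opprB addrACA [RHS]addrACA (addrC (- y)).
  by rewrite (le_trans (ler_normB _ _))//; lra.
have ns : `|rational_comb u s2| <= e / 2.
  have [N1 <-] := NP s2.
  have -> : N s2 (rational_comb u s2) = - N s2 ((x - y) - rational_comb u s2).
    by rewrite !linearB/= Nxy subrr sub0r opprK.
  by rewrite (le_trans (ler_norm _))// normrN (le_trans (N1 _)).
rewrite -(subrK (rational_comb u s2) (x - y)) (le_trans (ler_normD _ _))//; lra.
Qed.

Lemma bounded_weakly_cvg_subseq u (M : R) : reflexive_space V ->
  (forall k, `|u k| <= M) ->
  exists2 s : nat -> nat, increasing_seq s & exists x, weakly_cvg (u \o s) x.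
Proof.
move=> Vr uM.
have [N NP] := choice (fun s => norming_functional (rational_comb u s)).
have [G [GU ooG]] := ultraFilterLemma (_ : ProperFilter \oo).
have [x ux] := reflexive_ultralimit _ _ _ _ Vr GU uM.
(* Enumerates the norming functionals of all combinations; the default [[::]] only fills codes of no
   list. *)
pose g m := N (odflt [::] (unpickle m)).
have [s sincr gs] := diagonal_subsequence _ _ (fun m k => g m (u k))
  (fun m => g m x) _ ooG (fun m => ux (g m)).
exists s => //; exists x => f; apply: cvg_ultra => H HU ooH.
have [y uy] := reflexive_ultralimit _ _ _ _ Vr HU (fun k => uM (s k)).
suff -> : x = y by exact: uy.
(* An ultralimit of the subsequence along [H] is a limit of [u] itself along [s @ H], so both limits
   are compared inside the span of the same [u]. *)
apply: (weak_limit_unique G (s @ H) N u x y) => // t.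
have := gs (pickle t); rewrite /g pickleK/= => Nx.
by apply: (cvg_unique _ _ (uy (N t))) => //; apply: cvg_trans Nx; exact: cvg_app.
Qed.

End weak_compactness.

(** * Lower limits, and stability of relative critical points *)

Lemma limn_einf_ge_near (R : realType) (u : R^nat) (a e : R) :
  (a%:E <= limn_einf (fun k => (u k)%:E))%E -> 0 < e ->
  \forall n \near \oo, a - e < u n.
Proof.
move=> au e0.
have : ((a - e)%:E < limn_einf (fun k => (u k)%:E))%E.
  by apply: lt_le_trans au; rewrite lte_fin gtrBl.
(* The lower limit is the supremum of the tail infima, so one tail infimum already exceeds
   [a - e]. *)
rewrite limn_einf_lim (cvg_lim _ (@cvg_einfs_sup _ _))//.
move=> /ereal_sup_gt[_ [N _ <-]] aN; exists N => // n /= Nn.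
rewrite -lte_fin; apply: lt_le_trans aN _.
by apply: ereal_inf_lbound; exists n.
Qed.

Lemma increasing_seq_cvg_infty (s : nat -> nat) :
  increasing_seq s -> s @ \oo --> \oo.
Proof.
move=> sincr A [N _ NA]; exists N => // n /= Nn; apply: NA => /=.
apply: leq_trans Nn _; elim: n => // n IH.
by apply: leq_ltn_trans IH _; rewrite (leqW_mono sincr).
Qed.

Theorem theorem3p3 (R : realType) (X : completeNormedModType R)
  (Y : metricType R) (S : X -> Y -> R) (Reg : X -> R) (phi : X -> R)
  (S_ge0 : forall x y, 0 <= S x y)
  (Reg_ge0 : forall x, 0 <= Reg x)
  (phi_ge0 : forall x, 0 <= phi x)
  (C1 : reflexive_space X)
  (C2 : weakly_seq_lsc Reg)
  (C3 : relatively_subdifferentiable phi Reg)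
  (C4_lsc : weakly_seq_lsc2 S)
  (C4_convex : forall y, convex_function setT (fun x => S x y))
  (C4_continuous : forall x, continuous (S x))
  (C5 : exists C p : R, [/\ 0 < C, 1 <= p &
    forall z y y', S z y <= C * (S z y' + mdist y y' `^ p)])
  (C6 : forall (alpha : R) (y : Y), 0 < alpha ->
    coercive (tikhonov S Reg alpha y))
  (ydelta : Y) (alpha : R) (y_ : nat -> Y) (x_ : nat -> X) (z_ : nat -> dual X)
  (alpha_gt0 : 0 < alpha)
  (y_cvg : y_ k @[k --> \oo] --> ydelta)
  (z_subgrad : forall k, relative_subdifferential (fun u => alpha * phi u)
    (tikhonov S Reg alpha (y_ k)) (x_ k) (z_ k))
  (z_cvg0 : `|z_ k| @[k --> \oo] --> (0 : R))
  (zx_le0 : forall k, z_ k (x_ k) <= 0) :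
  (exists2 s : nat -> nat, increasing_seq s &
    exists x : X, weakly_cvg (x_ \o s) x) /\
  (forall (s : nat -> nat) (xplus : X), increasing_seq s ->
    weakly_cvg (x_ \o s) xplus ->
    relative_critical_point (fun u => alpha * phi u)
      (tikhonov S Reg alpha ydelta) xplus).
Proof.
have Tk_le k u : tikhonov S Reg alpha (y_ k) (x_ k) + z_ k u <=
    tikhonov S Reg alpha (y_ k) u + alpha * phi u.
  by apply: le_trans (z_subgrad k u); rewrite linearB/=; have := zx_le0 k; lra.
split.
  have [C [p [C0 p1 SC]]] := C5.
  have p0 : 0 <= p by rewrite (le_trans ler01).
  have [D [D0 yD]] : exists D : R, 0 <= D /\ forall k, mdist ydelta (y_ k) <= D.
    have d0 : mdist ydelta (y_ k) @[k --> \oo] --> (0 : R).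
      apply/cvgrPdist_lt => e e0.
      have yd := metricType_numDomainType.cvgr_dist_lt y_cvg e0.
      near=> k; rewrite sub0r normrN ger0_norm ?mdist_ge0//.
      by near: k; exact: yd.
    have /cvg_seq_bounded : cvgn (fun k => mdist ydelta (y_ k)).
      by apply/cvg_ex; exists 0.
    move=> /pinfty_ex_gt0[D D0 yD]; exists D; split=> [|k]; first exact: ltW.
    by rewrite (le_trans (ler_norm _))//; exact: yD.
  have yDp k : mdist ydelta (y_ k) `^ p <= D `^ p.
    by rewrite ge0_ler_powR// nnegrE// mdist_ge0.
  (* The right-hand side of [Tk_le] at [u = 0], with [y_ k] traded for [ydelta] through [C5]. *)
  pose B := C * (S 0 ydelta + D `^ p) + alpha * Reg 0 + alpha * phi 0.
  have TB k : tikhonov S Reg alpha (y_ k) (x_ k) <= B.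
    have := Tk_le k 0; rewrite linear0 addr0 => /le_trans; apply.
    rewrite /B /tikhonov !lerD2r (le_trans (SC 0 (y_ k) ydelta))//.
    by rewrite ler_wpM2l ?(ltW C0)// lerD2l metric_sym.
  (* [C5] in the other direction; both summands of the functional at [y_ k] are nonnegative, so each
     is at most [B]. *)
  have xB k : tikhonov S Reg alpha ydelta (x_ k) <= C * (B + D `^ p) + B.
    have := TB k; rewrite /tikhonov => TBk.
    have Rk : 0 <= alpha * Reg (x_ k) by rewrite mulr_ge0// ltW.
    have Sk := S_ge0 (x_ k) (y_ k).
    apply: lerD; last by lra.
    rewrite (le_trans (SC _ _ (y_ k)))// ler_wpM2l ?(ltW C0)// lerD//; lra.
  (* The [+ 1] puts the coercivity level strictly above the bound [xB], so no [x_ k] has norm above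
     [r]. *)
  have [r xr] := C6 alpha ydelta alpha_gt0 (C * (B + D `^ p) + B + 1).
  apply: (bounded_weakly_cvg_subseq x_ r C1) => k.
  by rewrite leNgt; apply/negP => /ltW/xr; have := xB k; lra.
move=> s xp sincr xsx u; rewrite dual0E addr0.
have soo := increasing_seq_cvg_infty _ sincr.
have ysy : y_ (s k) @[k --> \oo] --> ydelta by exact: cvg_comp soo y_cvg.
have Ssu : S u (y_ (s k)) @[k --> \oo] --> S u ydelta.
  exact: cvg_comp ysy (C4_continuous u ydelta).
have zs0 : `|z_ (s k)| @[k --> \oo] --> (0 : R) by exact: cvg_comp soo z_cvg0.
apply/ler_addgt0Pr => e e0.
have e4 : 0 < e / 4 by rewrite divr_gt0.
have u1 : 0 < `|u| + 1 by rewrite ltr_wpDl.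
have : \forall k \near \oo, S xp ydelta - e / 4 < S (x_ (s k)) (y_ (s k)).
  exact: limn_einf_ge_near (C4_lsc _ _ _ _ xsx ysy) e4.
have : \forall k \near \oo, Reg xp - e / 4 / alpha < Reg (x_ (s k)).
  exact: limn_einf_ge_near (C2 _ _ xsx) (divr_gt0 e4 alpha_gt0).
have /cvgrPdist_lt/(_ _ e4) := Ssu.
have /cvgrPdist_lt/(_ _ (divr_gt0 e4 u1)) := zs0.
move=> near1 near2 near3 near4.
(* The claim does not depend on [k]: one late index suffices. Four errors of [e / 4] come from [S]
   and [alpha * Reg] at [xp], from [S u], and from [z_ (s k) u]. *)
have : \forall k \near \oo, tikhonov S Reg alpha ydelta xp <=
    tikhonov S Reg alpha ydelta u + alpha * phi u + e.
  near=> k.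
  have k1 : `|0 - `|z_ (s k)| | < e / 4 / (`|u| + 1) by near: k; exact: near1.
  have k2 : `|S u ydelta - S u (y_ (s k))| < e / 4 by near: k; exact: near2.
  have k3 : Reg xp - e / 4 / alpha < Reg (x_ (s k)) by near: k; exact: near3.
  have k4 : S xp ydelta - e / 4 < S (x_ (s k)) (y_ (s k)).
    by near: k; exact: near4.
  have zu : - z_ (s k) u <= e / 4.
    rewrite (le_trans (ler_norm _))// normrN.
    rewrite (le_trans (le_dual_norm (z_ (s k)) u))//.
    move: k1; rewrite sub0r normrN normr_id ltr_pdivlMr// => /ltW; apply: le_trans.
    by apply: ler_wpM2l; [exact: dual_norm_ge0|rewrite lerDl].
  have Rk : alpha * Reg xp - e / 4 < alpha * Reg (x_ (s k)).
    move: k3; rewrite -(ltr_pM2l alpha_gt0) mulrBr; congr (_ - _ < _).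
    by rewrite mulrCA divff ?mulr1// lt0r_neq0.
  have := Tk_le (s k) u; rewrite /tikhonov.
  by move: k2; rewrite ltr_norml => /andP[]; lra.
by move=> /filter_ex[k].
Unshelve. all: by end_near. Qed.
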